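(* For each integer $k\geq 5$, there exist complex roots of unity $\epsilon_1,\dots,\epsilon_k$ such that the sum $\alpha=\sum_{i=1}^k\epsilon_i$ (of weight $k$) satisfies $$[\mathbb{Q}_{c(\alpha)}:\mathbb{Q}(\alpha)] > l(\alpha).$$
   Context: For a positive integer $n$, $\mathbb{Q}_n$ denotes the extension of $\mathbb{Q}$ generated by a primitive $n$th root of unity in $\mathbb{C}$. A cyclotomic integer is an algebraic integer that can be expressed as a sum of complex roots of unity (repetitions allowed). A representation $\alpha=\sum_{i=1}^k \epsilon_i$ with each $\epsilon_i$ a root of unity has weight $k$. The length $l(\alpha)$ of a cyclotomic integer $\alpha$ is the smallest weight among all representations of $\alpha$ as a sum of roots of unity. The conductor $c(\alpha)$ is the smallest positive integer such that $\mathbb{Q}(\alpha)\subseteq\mathbb{Q}_{c(\alpha)}$. *)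

(* Defs.v *)
(* The complex numbers are represented by [algC], the field of
   algebraic complex numbers, which contains every complex root of unity. *)
From mathcomp Require Import all_boot all_order all_algebra all_field.

Set Implicit Arguments.
Unset Strict Implicit.
Unset Printing Implicit Defensive.

Import Order.TTheory GRing.Theory Num.Theory.
Local Open Scope ring_scope.

(* The condition 0 < n matters: every x satisfies 0.-unity_root x. *)
Definition is_root_of_unity (x : algC) : Prop :=
  exists2 n : nat, (0 < n)%N & n.-unity_root x.

Definition is_least (P : nat -> Prop) (n : nat) : Prop :=
  P n /\ forall m : nat, P m -> (n <= m)%N.

(* Weights are positive: the empty sum is not a representation of 0, so the
   length of 0 is 2. *)
Definition has_weight (alpha : algC) (k : nat) : Prop :=
  (0 < k)%N /\
  exists eps : 'I_k -> algC,
    (forall i, is_root_of_unity (eps i)) /\ alpha = \sum_(i < k) eps i.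

Definition is_length (alpha : algC) (l : nat) : Prop :=
  is_least (has_weight alpha) l.

(* Q(x), the smallest subfield of algC containing x.  Closure under x / y for
   all y is harmless, since x / 0 = 0. *)
Definition Qadjoin (x : algC) : algC -> Prop := fun y =>
  forall S : {pred algC}, GRing.divring_closed S -> x \in S -> y \in S.

(* A primitive n-th root of unity for n > 0 (and the dummy value 1 at n = 0). *)
Definition zeta (n : nat) : algC :=
  if n is m.+1 then sval (C_prim_root_exists (ltn0Sn m)) else 1.

Definition Qcyc (n : nat) : algC -> Prop := Qadjoin (zeta n).

Definition is_conductor (alpha : algC) (c : nat) : Prop :=
  is_least (fun n => (0 < n)%N /\ forall y, Qadjoin alpha y -> Qcyc n y) c.

(* [E : F] = d for subfields F <= E of algC: E has a d-element basis as an
   F-vector space, i.e. every element of E is in exactly one way an F-linear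
   combination of b_0, ..., b_(d-1). *)
Definition is_degree (E F : algC -> Prop) (d : nat) : Prop :=
  (forall y, F y -> E y) /\
  exists b : 'I_d -> algC,
    (forall i, E (b i)) /\
    forall y, E y ->
      exists! a : {ffun 'I_d -> algC},
        (forall i, F (a i)) /\ y = \sum_(i < d) a i * b i.

(* Main.v *)
Require Import Defs.
From HB Require Import structures.
From mathcomp Require Import all_boot all_order all_algebra all_field.
From mathcomp Require Import boolp ring.
Import Order.TTheory GRing.Theory Num.Theory.
Local Open Scope ring_scope.

(* Let x and y be primitive 5th and 7th roots of unity and
   alpha = (x + x^4) + (y + y^2 + y^4), a sum of a Gauss period of order 2 and
   one of order 3.  Since 2x + 2x^4 + 1 and 2y + 2y^2 + 2y^4 + 1 square to 5 and
   -7, Q(alpha) = Q(sqrt 5, sqrt -7) has conductor 35 and index 6 in Q_35, with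
   basis x^i y^j (i < 2, j < 3), whereas l(alpha) <= 5.  Moreover
   x + x^4 = -1 - x^2 - x^3 shows that alpha also has weight 6, and adding 1 - 1
   gives every weight k >= 5. *)

(** * Roots of unity and weights *)

Lemma least_exists (P : nat -> Prop) (n : nat) : P n -> exists m, is_least P m.
Proof.
move=> Pn; have exP : exists m, `[< P m >] by exists n; apply/asboolP.
case: (ex_minnP exP) => m /asboolP Pm m_min.
by exists m; split=> // k Pk; apply: m_min; apply/asboolP.
Qed.

Lemma root_of_unityX (n : nat) (z : algC) (i : nat) :
  n.-primitive_root z -> is_root_of_unity (z ^+ i).
Proof.
move=> pz; exists n; first exact: prim_order_gt0 pz.
by apply/unity_rootP; rewrite exprAC (prim_expr_order pz) expr1n.
Qed.

Lemma root_of_unityN (z : algC) : is_root_of_unity z -> is_root_of_unity (- z).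
Proof.
case=> n n_gt0 /unity_rootP zn; exists (n * 2)%N; first by rewrite muln_gt0 n_gt0.
by apply/unity_rootP; rewrite mulnC exprM sqrrN exprAC zn expr1n.
Qed.

Lemma has_weight1 (z : algC) : is_root_of_unity z -> has_weight z 1.
Proof. by move=> zU; split=> //; exists (fun=> z); rewrite big_ord1. Qed.

Lemma has_weightD (x y : algC) (m n : nat) :
  has_weight x m -> has_weight y n -> has_weight (x + y) (m + n).
Proof.
move=> [m_gt0 [e [eU ->]]] [_ [f [fU ->]]]; split; first by rewrite addn_gt0 m_gt0.
exists (fun i => match split i with inl j => e j | inr j => f j end); split.
  by move=> i; case: (split i).
rewrite big_split_ord /=; congr (_ + _); apply: eq_bigr => i _.
  by rewrite (unsplitK (inl i)).
by rewrite (unsplitK (inr i)).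
Qed.

(** Adding 1 + (-1) raises a weight by 2, so two consecutive weights cover both parities. *)
Lemma has_weight_ge (x : algC) (m : nat) :
  has_weight x m -> has_weight x m.+1 -> forall k, (m <= k)%N -> has_weight x k.
Proof.
move=> xm xm1 k /subnK <-; elim/ltn_ind: (k - m)%N => -[|[|j]] IHj //.
have U1 : is_root_of_unity 1 by exists 1%N => //; apply/unity_rootP.
have := has_weightD _ _ _ _ (has_weightD _ _ _ _ (IHj j _) (has_weight1 _ U1))
  (has_weight1 _ (root_of_unityN _ U1)).
by rewrite addrK !addn1 !addSn; apply.
Qed.

Lemma zeta_prim (n : nat) : (0 < n)%N -> n.-primitive_root (zeta n).
Proof. by case: n => // n _; rewrite /zeta; case: C_prim_root_exists. Qed.

(** * Simple extensions of Q as subfields of [algC] *)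

(** A boolean form of [Qadjoin], so that it can carry a [divringClosed] structure and the [rpred]
    lemmas apply. *)
Definition Qadj (x : algC) : {pred algC} := fun y => `[< Qadjoin x y >].

Lemma QadjP (x y : algC) : reflect (Qadjoin x y) (y \in Qadj x).
Proof. exact: asboolP. Qed.

Lemma Qadj_divring_closed (x : algC) : GRing.divring_closed (Qadj x).
Proof.
split; first by apply/QadjP => S [].
  move=> y z /QadjP yP /QadjP zP; apply/QadjP => S cS xS.
  by case: (cS) => _ cB _; apply: cB; [exact: yP | exact: zP].
move=> y z /QadjP yP /QadjP zP; apply/QadjP => S cS xS.
by case: (cS) => _ _ cV; apply: cV; [exact: yP | exact: zP].
Qed.

HB.instance Definition _ (x : algC) :=
  GRing.isDivringClosed.Build algC (Qadj x) (Qadj_divring_closed x).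

Lemma Qadj_self (x : algC) : x \in Qadj x.
Proof. by apply/QadjP => S _. Qed.

Lemma Qadj_min (S : divringClosed algC) (x : algC) :
  x \in S -> {subset Qadj x <= S}.
Proof.
move=> xS y /QadjP; apply => //; split; first exact: rpred1.
  by move=> u v; exact: rpredB.
by move=> u v; exact: rpred_div.
Qed.

Lemma rpred_ratr (S : divringClosed algC) (q : rat) : ratr q \in S.
Proof. by rewrite /ratr rpred_div ?rpred_int. Qed.

(** The fixed points of [u] form a subfield, which contains Q(x) as soon as it contains x. *)
Lemma Qadjoin_fix (u : {rmorphism algC -> algC}) (x y : algC) :
  u x = x -> Qadjoin x y -> u y = y.
Proof.
move=> ux yP; apply/eqP; apply: (yP [pred w | u w == w]); last by rewrite inE ux.
split; first by rewrite inE rmorph1.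
  by move=> v w; rewrite !inE rmorphB => /eqP -> /eqP ->.
by move=> v w; rewrite !inE fmorph_div => /eqP -> /eqP ->.
Qed.

(* From p(y) y + c = 0 with c != 0 one reads off y^-1 = - p(y) / c. *)
Lemma subalgebra_inv (S : subringClosed algC) (y : algC) :
  (forall q : rat, ratr q \in S) -> y \in S -> y^-1 \in S.
Proof.
move=> ratS yS; have [->|y0] := eqVneq y 0; first by rewrite invr0 rpred0.
have hornS (p : {poly rat}) : (map_poly ratr p).[y] \in S.
  elim/poly_ind: p => [|p c IHp]; first by rewrite rmorph0 horner0 rpred0.
  rewrite rmorphD rmorphM /= map_polyX map_polyC !hornerE.
  by apply: rpredD; [apply: rpredM | apply: ratS].
have [p [_ /monic_neq0 p0 pP]] := minCpolyP y.
have: root (map_poly ratr p) y by rewrite pP dvdpp.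
elim/poly_ind: p p0 {pP} => [|p c IHp]; first by rewrite eqxx.
rewrite rmorphD rmorphM /= map_polyX map_polyC /root !hornerE /=.
(* If the constant term is 0, dividing by y != 0 leaves a nonzero polynomial of smaller degree that
   still vanishes at y. *)
have [->|c0 _ /eqP pyc] := eqVneq c 0.
  move=> pX0; rewrite raddf0 addr0 mulf_eq0 (negPf y0) orbF; apply: IHp.
  by apply: contraNneq pX0 => ->; rewrite mul0r addr0.
have cC0 : ratr c != 0 :> algC by rewrite fmorph_eq0.
suff -> : y^-1 = - (map_poly ratr p).[y] * ratr c^-1 by rewrite rpredM ?rpredN.
apply: (mulIf y0); rewrite mulVf // fmorphV mulrAC mulNr.
by move/eqP: pyc; rewrite addr_eq0 => /eqP ->; rewrite opprK mulfV.
Qed.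

(** * Spans over a subfield, and degrees *)

Definition span (K : {pred algC}) (n : nat) (b : 'I_n -> algC) : {pred algC} :=
  fun y => `[< exists a : {ffun 'I_n -> algC},
                 (forall i, a i \in K) /\ y = \sum_(i < n) a i * b i >].
Arguments span K {n} b.

Lemma spanP (K : {pred algC}) (n : nat) (b : 'I_n -> algC) (y : algC) :
  reflect (exists a : {ffun 'I_n -> algC},
             (forall i, a i \in K) /\ y = \sum_(i < n) a i * b i)
          (y \in span K b).
Proof. exact: asboolP. Qed.

Lemma span_zmod_closed (K : divringClosed algC) (n : nat) (b : 'I_n -> algC) :
  zmod_closed (span K b).
Proof.
split.
  apply/spanP; exists [ffun=> 0]; split=> [i|]; first by rewrite ffunE rpred0.
  by rewrite big1 // => i _; rewrite ffunE mul0r.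
move=> _ _ /spanP[a [aK ->]] /spanP[c [cK ->]]; apply/spanP.
exists [ffun i => a i - c i]; split=> [i|]; first by rewrite ffunE rpredB.
by rewrite -sumrB; apply: eq_bigr => i _; rewrite ffunE mulrBl.
Qed.

HB.instance Definition _ (K : divringClosed algC) (n : nat) (b : 'I_n -> algC) :=
  GRing.isZmodClosed.Build algC (span K b) (span_zmod_closed K n b).

Lemma spanZ (K : divringClosed algC) (n : nat) (b : 'I_n -> algC) (k y : algC) :
  k \in K -> y \in span K b -> k * y \in span K b.
Proof.
move=> kK /spanP[a [aK ->]]; apply/spanP.
exists [ffun i => k * a i]; split=> [i|]; first by rewrite ffunE rpredM.
by rewrite mulr_sumr; apply: eq_bigr => i _; rewrite ffunE mulrA.
Qed.

Lemma span_mem (K : divringClosed algC) (n : nat) (b : 'I_n -> algC) (i : 'I_n) :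
  b i \in span K b.
Proof.
apply/spanP; exists [ffun j => (j == i)%:R]; split=> [j|].
  by rewrite ffunE rpred_nat.
rewrite (bigD1 i) //= big1 ?addr0 ?ffunE ?eqxx ?mul1r // => j /negPf ji.
by rewrite ffunE ji mul0r.
Qed.

(** The hypotheses make the span a ring containing Q; its elements are algebraic over Q, so
    [subalgebra_inv] supplies their inverses. *)
Lemma span_divring_closed (K : divringClosed algC) (n : nat) (b : 'I_n -> algC) :
  1 \in span K b -> (forall i j, b i * b j \in span K b) ->
  GRing.divring_closed (span K b).
Proof.
move=> S1 bS.
have SM : {in span K b &, forall y w, y * w \in span K b}.
  move=> _ _ /spanP[a [aK ->]] /spanP[c [cK ->]].
  rewrite mulr_suml rpred_sum // => i _; rewrite mulr_sumr rpred_sum // => j _.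
  by rewrite mulrACA spanZ ?rpredM.
have cS : GRing.subring_closed (span K b) by split=> // y w; apply: rpredB.
(* The subring structure depends on the hypotheses on [b], so it is built locally. *)
pose T := HB.pack_for (subringClosed algC) (span K b)
  (GRing.isSubringClosed.Build algC (span K b) cS).
have SV y : y \in span K b -> y^-1 \in span K b.
  apply: (subalgebra_inv T) => q; rewrite -[ratr q]mulr1; apply: spanZ => //.
  exact: rpred_ratr.
by split=> // y w yS wS; [apply: rpredB | apply/SM/SV].
Qed.

Lemma is_degree_span (z w : algC) (n : nat) (b : 'I_n -> algC) :
  w \in Qadj z -> (forall i, b i \in Qadj z) ->
  {subset Qadj z <= span (Qadj w) b} ->
  (forall a : 'I_n -> algC, (forall i, a i \in Qadj w) ->
     \sum_(i < n) a i * b i = 0 -> forall i, a i = 0) ->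
  is_degree (Qadjoin z) (Qadjoin w) n.
Proof.
move=> wz bz zspan free; split.
  by move=> y /QadjP /(Qadj_min (Qadj z) _ wz) /QadjP.
exists b; split=> [i|y /QadjP /zspan /spanP[a [aK ->]]]; first exact/QadjP.
exists a; split=> [|c [cK /eqP]]; first by split=> // i; apply/QadjP.
rewrite -subr_eq0 -sumrB => /eqP eq0.
apply/ffunP => i; apply/eqP; rewrite -subr_eq0; apply/eqP.
apply: (free (fun i => a i - c i)) => [j|].
  by rewrite rpredB ?aK //; apply/QadjP.
by rewrite -[RHS]eq0; apply: eq_bigr => j _; rewrite mulrBl.
Qed.

(** * Cyclotomic automorphisms *)

(** By the Chinese remainder theorem some exponent e is k modulo p and 1 modulo m. It is coprime to
    pm, so raising pm-th roots of unity to the power e extends to an automorphism. *)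
Lemma cyclotomic_aut (p m k : nat) : coprime p m -> coprime k p ->
  {u : {rmorphism algC -> algC} | forall w,
     (w ^+ p = 1 -> u w = w ^+ k) /\ (w ^+ m = 1 -> u w = w)}.
Proof.
move=> pm kp; set e := chinese p m k 1.
have ep : e = k %[mod p] by rewrite chinese_modl.
have em : e = 1 %[mod m] by rewrite chinese_modr.
have e_co : coprime e (p * m).
  rewrite coprimeMr -coprime_modl ep coprime_modl kp.
  by rewrite -coprime_modl em coprime_modl coprime1n.
have [u uP] := Qn_aut_exists e_co; exists u => w; split=> w1.
  by rewrite uP ?exprM ?w1 ?expr1n // -(expr_mod e w1) ep expr_mod.
by rewrite uP 1?mulnC ?exprM ?w1 ?expr1n // -(expr_mod e w1) em expr_mod.
Qed.

Lemma prim_root_sum0 (n : nat) (z : algC) :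
  (1 < n)%N -> n.-primitive_root z -> \sum_(i < n) z ^+ i = 0.
Proof.
move=> n_gt1 pz; have z1 : z - 1 != 0.
  by rewrite subr_eq0 (eq_prim_root_expr pz 1 0) // mod0n modn_small.
by apply: (mulfI z1); rewrite -subrX1 (prim_expr_order pz) subrr mulr0.
Qed.

(** * The two Gauss periods *)

(** The exponents 1, 4 and 1, 2, 4 are the nonzero squares modulo 5 and modulo 7. *)
Definition period2 (x : algC) : algC := x + x ^+ 4.
Definition period3 (y : algC) : algC := y + y ^+ 2 + y ^+ 4.

Section Periods.

Variables x y : algC.
Hypotheses (px : 5.-primitive_root x) (py : 7.-primitive_root y).

Let a := period2 x.
Let b := period3 y.
Let alpha := a + b.

Lemma sum5 : 1 + x + x ^+ 2 + x ^+ 3 + x ^+ 4 = 0.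
Proof. by rewrite -(prim_root_sum0 5 x) // !big_ord_recr big_ord0 /= add0r. Qed.

Lemma sum7 : 1 + y + y ^+ 2 + y ^+ 3 + y ^+ 4 + y ^+ 5 + y ^+ 6 = 0.
Proof. by rewrite -(prim_root_sum0 7 y) // !big_ord_recr big_ord0 /= add0r. Qed.

Lemma period2_sqr : (2 * a + 1) ^+ 2 = 5.
Proof.
have x5 := prim_expr_order px; have s5 := sum5.
apply/eqP; rewrite -subr_eq0; apply/eqP.
(* The difference is written as a combination of x^5 - 1 and the cyclotomic sum, both of which
   vanish; the later identities on periods are proved in the same way. *)
transitivity (4 * x ^+ 3 * (x ^+ 5 - 1) + 8 * (x ^+ 5 - 1) +
  4 * (1 + x + x ^+ 2 + x ^+ 3 + x ^+ 4)); first by rewrite /a /period2; ring.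
by rewrite x5 s5 subrr; ring.
Qed.

Lemma period3_sqr : (2 * b + 1) ^+ 2 = - 7%:R.
Proof.
have y7 := prim_expr_order py; have s7 := sum7.
apply/eqP; rewrite -subr_eq0; apply/eqP.
transitivity (4 * y * (y ^+ 7 - 1) +
  8 * (1 + y + y ^+ 2 + y ^+ 3 + y ^+ 4 + y ^+ 5 + y ^+ 6));
  first by rewrite /b /period3; ring.
by rewrite y7 s7 subrr; ring.
Qed.

(** Equivalently, [a] differs from its conjugate -1 - a. *)
Lemma period2_neq : 2 * a + 1 != 0.
Proof.
apply/eqP => a0; move: period2_sqr; rewrite a0 expr0n /= => /esym /eqP.
by rewrite pnatr_eq0.
Qed.

Lemma period3_neq : 2 * b + 1 != 0.
Proof.
apply/eqP => b0; move: period3_sqr; rewrite b0 expr0n /= => /esym /eqP.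
by rewrite oppr_eq0 pnatr_eq0.
Qed.

(** As 2 is not a square modulo 5, [u] sends [a] to the other period x^2 + x^3, and the two periods
    add up to -1. *)
Lemma period2_conj (u : {rmorphism algC -> algC}) :
  u x = x ^+ 2 -> u a = - 1 - a.
Proof.
move=> ux; apply/eqP; rewrite -subr_eq0; apply/eqP.
rewrite /a /period2 rmorphD rmorphXn /= ux.
transitivity (x ^+ 3 * (x ^+ 5 - 1) + (1 + x + x ^+ 2 + x ^+ 3 + x ^+ 4));
  first by ring.
by rewrite (prim_expr_order px) sum5 subrr mulr0 addr0.
Qed.

(** As 6 is not a square modulo 7, [u] sends [b] to the other period y^3 + y^5 + y^6, and the two
    periods add up to -1. *)
Lemma period3_conj (u : {rmorphism algC -> algC}) :
  u y = y ^+ 6 -> u b = - 1 - b.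
Proof.
move=> uy; apply/eqP; rewrite -subr_eq0; apply/eqP.
rewrite /b /period3 !rmorphD !rmorphXn /= uy.
transitivity ((y ^+ 5 + y ^+ 17 + y ^+ 10 + y ^+ 3) * (y ^+ 7 - 1) +
  (1 + y + y ^+ 2 + y ^+ 3 + y ^+ 4 + y ^+ 5 + y ^+ 6));
  first by ring.
by rewrite (prim_expr_order py) sum7 subrr mulr0 addr0.
Qed.

(** If 5 does not divide n, some automorphism fixes Q_n and y but sends x to x^2; it moves [a],
    hence [alpha], which is thus outside Q_n. The same argument with y and y^6 shows that 7 divides
    n. *)
Lemma period_sum_conductor (n : nat) :
  (0 < n)%N -> Qcyc n alpha -> (35 <= n)%N.
Proof.
move=> n_gt0 alpha_n; have zn := prim_expr_order (zeta_prim n n_gt0).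
have fixed (u : {rmorphism algC -> algC}) : u (zeta n) = zeta n -> u alpha = alpha.
  by move=> uz; apply: Qadjoin_fix uz alpha_n.
suff: (5 * 7 %| n)%N by apply: dvdn_leq.
rewrite Gauss_dvd //; apply/andP; split; apply: contraT => ndvd.
(* The modulus 7n makes the automorphism fix both y and [zeta n]. *)
- have co : coprime 5 (7 * n) by rewrite coprimeMr /= prime_coprime.
  have [u uP] := cyclotomic_aut 5 (7 * n) 2 co isT.
  have ux : u x = x ^+ 2 by have [->] := uP x; rewrite ?(prim_expr_order px).
  have uy : u y = y.
    by have [_ ->] := uP y; rewrite ?exprM ?(prim_expr_order py) ?expr1n.
  have uz : u (zeta n) = zeta n.
    by have [_ ->] := uP (zeta n); rewrite 1?mulnC ?exprM ?zn ?expr1n.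
  have ub : u b = b by rewrite /b /period3 !rmorphD !rmorphXn /= uy.
  have := fixed u uz; rewrite /alpha rmorphD /= ub (period2_conj u ux) => /addIr e.
  by case/eqP: period2_neq; transitivity (a - (- 1 - a)); [ring | rewrite e subrr].
- have co : coprime 7 (5 * n) by rewrite coprimeMr /= prime_coprime.
  have [u uP] := cyclotomic_aut 7 (5 * n) 6 co isT.
  have uy : u y = y ^+ 6 by have [->] := uP y; rewrite ?(prim_expr_order py).
  have ux : u x = x.
    by have [_ ->] := uP x; rewrite ?exprM ?(prim_expr_order px) ?expr1n.
  have uz : u (zeta n) = zeta n.
    by have [_ ->] := uP (zeta n); rewrite 1?mulnC ?exprM ?zn ?expr1n.
  have ua : u a = a by rewrite /a /period2 !rmorphD !rmorphXn /= ux.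
  have := fixed u uz; rewrite /alpha rmorphD /= ua (period3_conj u uy) => /addrI e.
  by case/eqP: period3_neq; transitivity (b - (- 1 - b)); [ring | rewrite e subrr].
Qed.

(* With s = 2a+1 = sqrt 5, t = 2b+1 = sqrt -7 and g = s + t = 2 alpha + 2,
   one has g (s - t) = 12, so g + 12/g = 2s. *)
Lemma period2_in : a \in Qadj alpha.
Proof.
pose g := 2 * alpha + 2.
have gE : g * (2 * a - 2 * b) = 12.
  transitivity ((2 * a + 1) ^+ 2 - (2 * b + 1) ^+ 2); first by rewrite /g /alpha; ring.
  by rewrite period2_sqr period3_sqr; ring.
have g0 : g != 0.
  by apply/eqP => g0; move/esym/eqP: gE; rewrite g0 mul0r pnatr_eq0.
have -> : a = (g + 12 / g - 2) / 4 by rewrite -gE mulrAC mulfV // /g /alpha; field.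
rewrite rpred_div ?rpred_nat // rpredB ?rpred_nat // rpredD //.
  by rewrite rpredD ?rpredM ?rpred_nat // Qadj_self.
by rewrite rpred_div ?rpred_nat // rpredD ?rpredM ?rpred_nat // Qadj_self.
Qed.

Lemma period3_in : b \in Qadj alpha.
Proof.
by rewrite (_ : b = alpha - a);
  [rewrite rpredB ?period2_in ?Qadj_self | rewrite /alpha; ring].
Qed.

(** * A basis of six monomials over Q(alpha) *)

Definition mono_basis (i : 'I_6) : algC := x ^+ (i %/ 3) * y ^+ (i %% 3).

(** Exponents are lowered by the relations of degree 2 and 3 over Q(alpha) whose roots are x, x^4
    and y, y^2, y^4; their coefficients are polynomials in [a] and [b]. *)
Lemma mono_in_span (m n : nat) : x ^+ m * y ^+ n \in span (Qadj alpha) mono_basis.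
Proof.
have base i j : (i < 2)%N -> (j < 3)%N ->
    x ^+ i * y ^+ j \in span (Qadj alpha) mono_basis.
  move=> i2 j3; have ij : (i * 3 + j < 6)%N.
    by case: i i2 => [|[|]] // _; rewrite ltn_add2l (leq_trans j3).
  have := span_mem (Qadj alpha) 6 mono_basis (Ordinal ij).
  by rewrite /mono_basis /= divnMDl // divn_small // addn0 modnMDl modn_small.
have x2 : x ^+ 2 = a * x - 1.
  apply/eqP; rewrite -subr_eq0; apply/eqP.
  transitivity (- (x ^+ 5 - 1)); first by rewrite /a /period2; ring.
  by rewrite (prim_expr_order px) subrr oppr0.
have y3 : y ^+ 3 = b * y ^+ 2 + (1 + b) * y + 1.
  apply/eqP; rewrite -subr_eq0; apply/eqP.
  transitivity (- (1 + y + y ^+ 2 + y ^+ 3 + y ^+ 4 + y ^+ 5 + y ^+ 6));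
  first by rewrite /b /period3; ring.
  by rewrite sum7 oppr0.
have aK := period2_in; have bK := period3_in.
have stepx i j : x ^+ i.+2 * y ^+ j = a * (x ^+ i.+1 * y ^+ j) - x ^+ i * y ^+ j.
  by rewrite -addn2 exprD x2 exprS; ring.
have stepy i j : x ^+ i * y ^+ j.+3 =
    b * (x ^+ i * y ^+ j.+2) + (1 + b) * (x ^+ i * y ^+ j.+1) + x ^+ i * y ^+ j.
  by rewrite -addn3 exprD y3 !exprS; ring.
have b1K : 1 + b \in Qadj alpha by rewrite rpredD ?rpred1.
elim/ltn_ind: n m => -[|[|[|n]]] IHn m; last first.
  rewrite stepy; apply: rpredD; [apply: rpredD; apply: spanZ => //|];
    by apply: IHn; rewrite !ltnS ?leqnSn ?leqW.
all: elim/ltn_ind: m => -[|[|m]] IHm; [exact: base | exact: base | rewrite stepx].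
all: by apply: rpredB; [apply: spanZ => //|]; apply: IHm; rewrite ltnS ?leqnSn.
Qed.

(** A polynomial with at least as many distinct roots as listed coefficients is zero. This replaces
    a Vandermonde determinant in the independence proof. *)
Lemma coef_seq_eq0 (s rs : seq algC) :
  (size s <= size rs)%N -> uniq rs -> {in rs, forall z, (Poly s).[z] = 0} ->
  forall i, s`_i = 0.
Proof.
move=> le_s_rs rs_uniq rs0 i; rewrite -coef_Poly.
rewrite (roots_geq_poly_eq0 (p := Poly s) _ rs_uniq) ?coef0 //.
  by apply/allP => z /rs0 /eqP.
exact: leq_trans (size_Poly s) le_s_rs.
Qed.

(** Automorphisms fixing Q(alpha) carry the relation to all six pairs of conjugates of x and y. A
    polynomial of degree below 2 in x and below 3 in y that vanishes on this 2 by 3 grid is zero. *)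
Lemma mono_basis_free (c : 'I_6 -> algC) :
  (forall i, c i \in Qadj alpha) ->
  \sum_(i < 6) c i * mono_basis i = 0 -> forall i, c i = 0.
Proof.
move=> cK c0; have x5 := prim_expr_order px; have y7 := prim_expr_order py.
have conj0 k j : k \in [:: 1; 4]%N -> j \in [:: 1; 2; 4]%N ->
    \sum_(i < 6) c i * ((x ^+ k) ^+ (i %/ 3) * (y ^+ j) ^+ (i %% 3)) = 0.
  move=> k14 j124.
  have [|u uP] := cyclotomic_aut 5 7 k isT.
    by move: k14; rewrite !inE => /orP[] /eqP ->.
  have [|v vP] := cyclotomic_aut 7 5 j isT.
    by move: j124; rewrite !inE => /or3P[] /eqP ->.
  have [/(_ x5) ux _] := uP x; have [_ /(_ y7) uy] := uP y.
  have [_ /(_ x5) vx] := vP x; have [/(_ y7) vy _] := vP y.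
  (* Multiplication by a square permutes the squares modulo 5, so [u] only permutes the terms of
     [a]; likewise for [v] and [b] modulo 7. *)
  have ua : u a = a.
    rewrite /a /period2 rmorphD rmorphXn ux.
    move: k14; rewrite !inE => /orP[] /eqP -> //.
    by rewrite -!exprM -(expr_mod 16 x5) addrC.
  have vb : v b = b.
    rewrite /b /period3 !rmorphD !rmorphXn vy.
    move: j124; rewrite !inE => /or3P[] /eqP -> //.
      by rewrite -!exprM -(expr_mod 8 y7) addrC addrA.
    by rewrite -!exprM -(expr_mod 8 y7) -(expr_mod 16 y7) -addrA addrC.
  have fix_u w : w \in Qadj alpha -> u w = w.
    move/QadjP; apply: Qadjoin_fix; rewrite rmorphD ua; congr (_ + _).
    by rewrite /b /period3 !rmorphD !rmorphXn uy.
  have fix_v w : w \in Qadj alpha -> v w = w.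
    move/QadjP; apply: Qadjoin_fix; rewrite rmorphD vb; congr (_ + _).
    by rewrite /a /period2 !rmorphD !rmorphXn vx.
  transitivity (v (u (\sum_(i < 6) c i * mono_basis i))); last by rewrite c0 !rmorph0.
  rewrite !rmorph_sum; apply: eq_bigr => i _.
  rewrite /mono_basis 2!rmorphM /= fix_u // fix_v // !rmorphM !rmorphXn.
  by rewrite ux uy rmorphXn vx vy.
have y_uniq : uniq [:: y; y ^+ 2; y ^+ 4].
  by rewrite -[in y :: _](expr1 y) /= !inE !(eq_prim_root_expr py).
have x_uniq : uniq [:: x; x ^+ 4].
  by rewrite -[in x :: _](expr1 x) /= !inE !(eq_prim_root_expr px).
pose d (i : nat) := c (inord i).
have dE i : d (nat_of_ord i) = c i by rewrite /d inord_val.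
(* With the conjugate of x fixed, the relation is a polynomial in y of degree at most 2 with three
   distinct roots. *)
have Cx k : k \in [:: 1; 4]%N -> forall i,
    [:: d 0%N + d 3%N * x ^+ k; d 1%N + d 4%N * x ^+ k; d 2%N + d 5%N * x ^+ k]`_i = 0.
  move=> k14; apply: (coef_seq_eq0 _ [:: y; y ^+ 2; y ^+ 4]) => // v.
  have -> : (Poly [:: d 0%N + d 3%N * x ^+ k; d 1%N + d 4%N * x ^+ k;
                d 2%N + d 5%N * x ^+ k]).[v] =
      \sum_(i < 6) c i * ((x ^+ k) ^+ (i %/ 3) * v ^+ (i %% 3)).
    under [RHS]eq_bigr do rewrite -dE.
    by rewrite horner_Poly /= !big_ord_recr big_ord0 /=; ring.
  rewrite !inE => /or3P[] /eqP ->;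
    [exact: (conj0 k 1%N) | exact: (conj0 k 2%N) | exact: (conj0 k 4%N)].
(* Each coefficient found in [Cx] is in turn a polynomial of degree at most 1 with the two roots x
   and x^4. *)
have dd j : (j < 3)%N -> forall i, [:: d j; d (3 + j)%N]`_i = 0.
  move=> j3; apply: (coef_seq_eq0 _ [:: x; x ^+ 4]) => // w.
  rewrite horner_Poly /= mul0r add0r addrC !inE => /orP[] /eqP ->.
    by have := Cx 1%N isT j; case: j j3 => [|[|[|]]].
  by have := Cx 4%N isT j; case: j j3 => [|[|[|]]].
move=> i; rewrite -dE; have [i3|i3] := ltnP i 3; first exact: (dd i i3 0%N).
by rewrite -(subnKC i3); apply: (dd (i - 3)%N _ 1%N); rewrite ltn_subLR.
Qed.

End Periods.

(** * Weights and degree of the sum of the periods *)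

Lemma period_sum_weight5 (x y : algC) :
  5.-primitive_root x -> 7.-primitive_root y ->
  has_weight (period2 x + period3 y) 5.
Proof.
move=> px py; rewrite /period2 /period3.
have X i := has_weight1 _ (root_of_unityX 5 x i px).
have Y i := has_weight1 _ (root_of_unityX 7 y i py).
exact: has_weightD (has_weightD _ _ _ _ (X 1%N) (X 4%N))
  (has_weightD _ _ _ _ (has_weightD _ _ _ _ (Y 1%N) (Y 2%N)) (Y 4%N)).
Qed.

(* The vanishing sum 1 + x + x^2 + x^3 + x^4 trades the two terms x + x^4 for
   the three terms - 1 - x^2 - x^3. *)
Lemma period_sum_weight6 (x y : algC) :
  5.-primitive_root x -> 7.-primitive_root y ->
  has_weight (period2 x + period3 y) 6.
Proof.
move=> px py.
have X i := has_weight1 _ (root_of_unityN _ (root_of_unityX 5 x i px)).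
have Y i := has_weight1 _ (root_of_unityX 7 y i py).
have -> : period2 x = - x ^+ 0 + - x ^+ 2 + - x ^+ 3.
  apply/eqP; rewrite -subr_eq0 -(sum5 x px) /period2; apply/eqP; ring.
exact: has_weightD
  (has_weightD _ _ _ _ (has_weightD _ _ _ _ (X 0%N) (X 2%N)) (X 3%N))
  (has_weightD _ _ _ _ (has_weightD _ _ _ _ (Y 1%N) (Y 2%N)) (Y 4%N)).
Qed.

Lemma period_sum_degree (z : algC) : 35.-primitive_root z ->
  is_degree (Qadjoin z) (Qadjoin (period2 (z ^+ 7) + period3 (z ^+ 5))) 6.
Proof.
move=> pz; set alpha := period2 _ + _.
have px : 5.-primitive_root (z ^+ 7) by exact: (dvdn_prim_root pz (m := 5)).
have py : 7.-primitive_root (z ^+ 5) by exact: (dvdn_prim_root pz (m := 7)).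
have zK := Qadj_self z.
have span_mono := mono_in_span _ _ px py.
apply: (is_degree_span _ _ _ (mono_basis (z ^+ 7) (z ^+ 5))).
- by rewrite /alpha /period2 /period3 !rpredD ?rpredX.
- by move=> i; rewrite /mono_basis rpredM ?rpredX.
- have cS : GRing.divring_closed (span (Qadj alpha) (mono_basis (z ^+ 7) (z ^+ 5))).
    apply: span_divring_closed => [|i j].
      by rewrite -[1]mulr1; apply: (span_mono 0%N 0%N).
    by rewrite /mono_basis mulrACA -!exprD; apply: span_mono.
  (* The generator z is itself a monomial: (z^7)^3 (z^5)^3 = z^36 = z. *)
  move=> y /QadjP; apply=> //; have := span_mono 3%N 3%N.
  by rewrite -!exprM -exprD -(prim_expr_mod pz).
- exact: mono_basis_free.
Qed.

Theorem corollary1 :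
  forall k : nat, (5 <= k)%N ->
  exists eps : 'I_k -> algC,
    (forall i, is_root_of_unity (eps i)) /\
    let alpha := \sum_(i < k) eps i in
    exists c l d : nat,
      [/\ is_conductor alpha c,
          is_length alpha l,
          is_degree (Qcyc c) (Qadjoin alpha) d
        & (l < d)%N].
Proof.
move=> k k5; have pz := zeta_prim 35 isT; set z := zeta 35 in pz.
have px : 5.-primitive_root (z ^+ 7) by exact: (dvdn_prim_root pz (m := 5)).
have py : 7.-primitive_root (z ^+ 5) by exact: (dvdn_prim_root pz (m := 7)).
have w5 := period_sum_weight5 _ _ px py; have w6 := period_sum_weight6 _ _ px py.
have deg := period_sum_degree z pz.
have [_ [eps [epsU alphaE]]] := has_weight_ge _ _ w5 w6 k k5.
exists eps; split=> //=; rewrite -alphaE.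
(* The exact length is not computed: being at most 5, it is below the degree 6. *)
have [l lmin] := least_exists _ _ w5.
exists 35%N, l, 6%N; split=> //.
- split; first by split=> // y; case: deg => + _; apply.
  move=> n [n_gt0 sub]; apply: (period_sum_conductor _ _ px py n n_gt0).
  by apply: sub; apply/QadjP/Qadj_self.
- by rewrite ltnS; case: lmin => _; apply.
Qed.
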